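(* Let $n\ge1$, let $q\in\mathbb{N}$, and let $\{X^v\}_{v\in\mathbb{N}^n}$ be a one-critical, exhaustive $n$-parameter filtration of a cell complex $X$. Fix $u\in\mathbb{N}^n$, and suppose that $$B_q(X^u)=\sum_{j=1}^nB_q(X^{u-e_j})$$ and that there exists a permutation $\rho$ of $[n]$ such that, for every $\ell\in[n]$, $$Z_q(X^{u-e_{\rho(\ell)}})\cap\Big(\sum_{j<\ell}Z_q(X^{u-e_{\rho(j)}})\Big)=\sum_{j<\ell}Z_q(X^{u-e_{\rho(j)}-e_{\rho(\ell)}}).$$ Then $\xi_1^q(u)=0$.
   Context: $\mathbb{F}$ is a fixed field, $\mathbb{N}=\{0,1,\dots\}$, $[n]=\{1,\dots,n\}$, $e_1,\dots,e_n$ is the standard basis of $\mathbb{N}^n$, and $\preceq$ is the coordinatewise order on $\mathbb{N}^n$. A cell complex is a finite graded set $X=\bigsqcup_{q\in\mathbb{N}}X_q$ (elements of $X_q$ are $q$-cells) with an incidence function $\kappa:X\times X\to\mathbb{F}$ such that $\kappa(\tau,\sigma)\neq0$ implies $\dim\tau=\dim\sigma+1$, and $\sum_{\rho\in X}\kappa(\tau,\rho)\kappa(\rho,\sigma)=0$ for all $\tau,\sigma$. The face partial order $\le$ on $X$ is generated by $\sigma<\tau$ whenever $\kappa(\tau,\sigma)\ne0$. $C_*(X)$ is the chain complex with $C_q(X)$ the $\mathbb{F}$-vector space with basis $X_q$ and $\partial_q(\tau)=\sum_{\sigma\in X_{q-1}}\kappa(\tau,\sigma)\sigma$ (with $C_q=0$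 for $q<0$). A subcomplex is a subset closed under passing to faces, with the restricted incidence function. $H_q$ denotes homology. An $n$-parameter filtration of $X$ is a family of subcomplexes $\{X^u\}_{u\in\mathbb{N}^n}$ with $X^u\subseteq X^v$ for $u\preceq v$; one sets $X^w=\emptyset$ if $w\notin\mathbb{N}^n$. It is exhaustive if $X=\bigcup_uX^u$. It is one-critical if $X^u=\{\sigma\in X\mid h(\sigma)\preceq u\}$ for some order-preserving $h:(X,\le)\to(\mathbb{N}^n,\preceq)$. $Z_q(X^v)=\ker(\partial_q:C_q(X^v)\to C_{q-1}(X^v))$ and $B_q(X^v)=\operatorname{im}(\partial_{q+1}:C_{q+1}(X^v)\to C_q(X^v))$, all regarded as subspaces of $C_q(X)$; empty sums of subspaces are $0$. $S=\mathbb{F}[x_1,\dots,x_n]$; $V_q=\bigoplus_{u\in\mathbb{N}^n}H_q(X^u)$ is the $n$-graded $S$-module on which $x_i$ acts by the maps $H_q(X^u)\to H_q(X^{u+e_i})$ induced by inclusion, and $\xi_1^q(u)=\dim_{\mathbb{F}}(\operatorname{Tor}_1^S(V_q,\mathbb{F}))^u$, where $\mathbb{F}=S/\langle x_1,\dots,x_n\rangle$. *)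

(* Defs.v *)
From HB Require Import structures.
From mathcomp Require Import all_boot all_order all_fingroup all_algebra.

Set Implicit Arguments.
Unset Strict Implicit.
Unset Printing Implicit Defensive.

Import GRing.Theory.
Local Open Scope ring_scope.

Section Subquotient.
Variables (F : fieldType) (vT : vectType F).
Implicit Types U W : {vspace vT}.

(* The quotient U / W, for W <= U, carried by a complement of W in U; the class
   map of an element of U is the projection onto this complement along W.
   Lemmas clsE0, cls_repr and indE are its characteristic properties. *)
Definition subquo U W := subvs_of (U :\: W)%VS.

Definition repr_sq U W : 'Hom(subquo U W, vT) := linfun vsval.
Definition cls U W : 'Hom(vT, subquo U W) :=
  linfun (vsproj (U :\: W)%VS \o addv_pi1 U W).

Lemma repr_sqE U W (y : subquo U W) : repr_sq U W y = vsval y.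
Proof. by rewrite lfunE. Qed.

Lemma val_cls U W x : vsval (cls U W x) = addv_pi1 U W x.
Proof. by rewrite lfunE /= vsprojK // memv_pi. Qed.

Lemma repr_mem U W (y : subquo U W) : repr_sq U W y \in U.
Proof. by rewrite repr_sqE; apply: subvP (diffvSl U W) _ (subvsP y). Qed.

Lemma cls_repr U W (y : subquo U W) : cls U W (repr_sq U W y) = y.
Proof.
apply: val_inj; rewrite [LHS]val_cls repr_sqE daddv_pi_id ?capv_diff //.
exact: subvsP.
Qed.

Lemma cls_sub U W x : x \in U -> x - repr_sq U W (cls U W x) \in W.
Proof.
move=> Ux; rewrite repr_sqE val_cls.
have UWx : x \in (U + W)%VS by apply: subvP (addvSl U W) _ Ux.
by rewrite -{1}(addv_pi1_pi2 UWx) addrC addKr memv_pi2.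
Qed.

Lemma clsE0 U W x : x \in U -> (cls U W x == 0) = (x \in W).
Proof.
move=> Ux; have Wx := cls_sub W Ux.
apply/eqP/idP => [x0|xW]; first by rewrite x0 linear0 subr0 in Wx.
apply: val_inj; rewrite [LHS]val_cls /=; apply/eqP.
have: addv_pi1 U W x \in ((U :\: W) :&: W)%VS.
  rewrite memv_cap memv_pi -val_cls -repr_sqE /=.
  by have := memvB xW Wx; rewrite opprB addrCA subrr addr0.
by rewrite capv_diff memv0.
Qed.

End Subquotient.

(* The map U / W -> U' / W' induced by f, when f U <= U' and f W <= W'. *)
Definition ind (F : fieldType) (vT wT : vectType F) (f : 'Hom(vT, wT))
    (U W : {vspace vT}) (U' W' : {vspace wT}) :
  'Hom(subquo U W, subquo U' W') :=
  (cls U' W' \o f \o repr_sq U W)%VF.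

Lemma indE (F : fieldType) (vT wT : vectType F) (f : 'Hom(vT, wT))
    (U W : {vspace vT}) (U' W' : {vspace wT}) (x : vT) :
    (W <= U)%VS -> (f @: U <= U')%VS -> (f @: W <= W')%VS -> x \in U ->
  ind f U W U' W' (cls U W x) = cls U' W' (f x).
Proof.
move=> sWU fU fW Ux; rewrite !comp_lfunE; apply/eqP.
rewrite eq_sym -subr_eq0 -!raddfB /= clsE0.
  by apply: (subvP fW); apply: memv_img; apply: cls_sub.
apply: (subvP fU); apply: memv_img; rewrite memvB ?repr_mem //.
Qed.

Notation point n := {ffun 'I_n -> nat}.

Definition lep (n : nat) (u v : point n) : bool := [forall i, u i <= v i]%N.
Notation "u '<=p' v" := (lep u v) (at level 70, no associativity).

Lemma lepP n (u v : point n) : reflect (forall i, u i <= v i)%N (u <=p v).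
Proof. exact: forallP. Qed.

Lemma lep_refl n (u : point n) : u <=p u.
Proof. by apply/lepP. Qed.

Lemma lep_trans n (v u w : point n) : u <=p v -> v <=p w -> u <=p w.
Proof.
by move=> /lepP uv /lepP vw; apply/lepP => i; apply: leq_trans (uv i) (vw i).
Qed.

(* u - e_j; only used when 0 < u j *)
Definition pred_pt (n : nat) (u : point n) (j : 'I_n) : point n :=
  [ffun i => u i - (i == j)]%N.

Lemma lep_pred n (u : point n) j : pred_pt u j <=p u.
Proof. by apply/lepP => i; rewrite ffunE leq_subr. Qed.

(* An n-graded module over S = F[x_1, ..., x_n], graded by N^n and finite
   dimensional in each degree, given by its homogeneous components and, for
   u <=p v, the action  gmul u v : M^u -> M^v  of the monomial x^(v - u).
   (These monomials are a basis of S, so nothing else is needed; x_j acts by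
   gmul u (u + e_j).)  The value of gmul u v is irrelevant unless u <=p v. *)
Record gmodule (F : fieldType) (n : nat) := GModule {
  gcomp :> point n -> vectType F;
  gmul : forall u v : point n, 'Hom(gcomp u, gcomp v);
  gmul_id : forall u, gmul u u = \1%VF;
  gmul_comp : forall u v w, u <=p v -> v <=p w ->
    (gmul v w \o gmul u v)%VF = gmul u w
}.

Record ghom (F : fieldType) (n : nat) (M N : gmodule F n) := GHom {
  ghom_fun :> forall u : point n, 'Hom(M u, N u);
  ghom_mul : forall u v, u <=p v ->
    (gmul N u v \o ghom_fun u)%VF = (ghom_fun v \o gmul M u v)%VF
}.

(* M has a homogeneous S-basis (g_j), g_j of degree a_j: in each degree u, only
   finitely many a_j are <=p u, and the x^(u - a_j) g_j for those j form an
   F-basis of M^u. *)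
Definition gfree (F : fieldType) (n : nat) (M : gmodule F n) : Prop :=
  exists (J : choiceType) (a : J -> point n) (g : forall j, M (a j)),
  forall u, exists s : seq J,
    [/\ uniq s, forall j, (j \in s) = (a j <=p u)
      & basis_of fullv [seq gmul M (a j) u (g j) | j <- s]].

Record free_resolution (F : fieldType) (n : nat) (M : gmodule F n) :=
  FreeResolution {
  fr_mod :> nat -> gmodule F n;
  fr_free : forall k, gfree (fr_mod k);
  fr_d : forall k, ghom (fr_mod k.+1) (fr_mod k);
  fr_aug : ghom (fr_mod 0) M;
  fr_aug_surj : forall u, limg (fr_aug u) = fullv;
  fr_exact0 : forall u, limg (fr_d 0 u) = lker (fr_aug u);
  fr_exact : forall k u, limg (fr_d k.+1 u) = lker (fr_d k u)
}.

(* degree u component of <x_1, ..., x_n> M *)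
Definition maxM (F : fieldType) (n : nat) (M : gmodule F n) (u : point n) :
  {vspace M u} :=
  (\sum_(j < n | (0 < u j)%N) limg (gmul M (pred_pt u j) u))%VS.

(* degree u component of  M (x)_S F = M / <x_1, ..., x_n> M *)
Definition tensF (F : fieldType) (n : nat) (M : gmodule F n) (u : point n) :=
  subquo (fullv : {vspace M u}) (maxM M u).

Definition tensF_map (F : fieldType) (n : nat) (M N : gmodule F n)
    (f : ghom M N) (u : point n) : 'Hom(tensF M u, tensF N u) :=
  ind (f u) fullv (maxM M u) fullv (maxM N u).

Section Tor.
Variables (F : fieldType) (n : nat) (M : gmodule F n) (P : free_resolution M).

Definition tor_cycles (i : nat) (u : point n) : {vspace tensF (P i) u} :=
  match i return {vspace tensF (P i) u} with
  | 0 => fullv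
  | k.+1 => lker (tensF_map (fr_d P k) u)
  end.

(* degree u component of Tor_i^S(M, F) = H_i(P (x)_S F) *)
Definition Tor (i : nat) (u : point n) :=
  subquo (tor_cycles i u) (limg (tensF_map (fr_d P i) u)).

Definition tor_dim (i : nat) (u : point n) : nat :=
  \dim (fullv : {vspace Tor i u}).

End Tor.

(* This section constructs std_resolution, so that quantifying over the free
   resolutions of a module is never vacuous; nothing later depends on it. *)

(* The free module on generators j of degree a j, where below u lists the j
   with a j <=p u; ext extends a coefficient vector by zero. *)
Section FreeModule.
Variables (F : fieldType) (n : nat) (J : choiceType) (a : J -> point n).
Variable below : point n -> seq J.
Hypothesis below_uniq : forall u, uniq (below u).
Hypothesis mem_below : forall u j, (j \in below u) = (a j <=p u).

Notation coef u := {ffun seq_sub (below u) -> F^o}.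

Definition ext (u : point n) (c : coef u) (j : J) : F :=
  oapp c 0 (insub j).

Lemma ext_val u (c : coef u) i : ext c (val i) = c i.
Proof. by rewrite /ext valK. Qed.

Lemma ext_out u (c : coef u) j : ~~ (a j <=p u) -> ext c j = 0.
Proof. by move=> ju; rewrite /ext insubN // mem_below. Qed.

Lemma ext_linear u k (c d : coef u) j : ext (k *: c + d) j = k * ext c j + ext d j.
Proof.
by rewrite /ext; case: insub => [i|] /=; rewrite ?ffunE ?mulr0 ?addr0.
Qed.

Definition free_mul_fun u v (c : coef u) : coef v := [ffun j => ext c (val j)].

Lemma free_mul_fun_linear u v : linear (@free_mul_fun u v).
Proof. by move=> k c d; apply/ffunP => i; rewrite !ffunE ext_linear. Qed.
HB.instance Definition _ u v := GRing.isLinear.Build F (coef u) (coef v) _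
  (@free_mul_fun u v) (@free_mul_fun_linear u v).

Definition free_mul u v : 'Hom(coef u, coef v) := linfun (@free_mul_fun u v).

Lemma ext_mul u v (c : coef u) j : u <=p v -> ext (free_mul u v c) j = ext c j.
Proof.
move=> uv; rewrite lfunE /ext; case: insubP => [i _ <-|jv] /=.
  by rewrite ffunE.
rewrite insubN //; apply: contra jv; rewrite !mem_below => ju.
exact: lep_trans ju uv.
Qed.

Lemma free_mul_id u : free_mul u u = \1%VF.
Proof.
by apply/lfunP => c; rewrite id_lfunE lfunE; apply/ffunP=> i; rewrite ffunE ext_val.
Qed.

Lemma free_mul_comp u v w : u <=p v -> v <=p w ->
  (free_mul v w \o free_mul u v)%VF = free_mul u w.
Proof.
move=> uv vw; apply/lfunP => c; rewrite comp_lfunE.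
apply/ffunP => i; rewrite -!ext_val !ext_mul //; exact: lep_trans uv vw.
Qed.

Definition free_gmodule : gmodule F n :=
  @GModule F n (fun u => coef u) free_mul free_mul_id free_mul_comp.

Definition gen u j : coef u := [ffun i => (val i == j)%:R].

Lemma ext_gen u j k : a j <=p u -> ext (gen u j) k = (k == j)%:R.
Proof.
move=> ju; rewrite /ext; case: insubP => [i _ <-|ku] /=; first by rewrite ffunE.
by case: eqP ku => // ->; rewrite mem_below ju.
Qed.

Lemma free_gmodule_free : gfree free_gmodule.
Proof.
exists J, a, (fun j => gen (a j) j) => u; exists (below u); split => //.
have mulE j : j \in below u -> free_mul (a j) u (gen (a j) j) = gen u j.
  rewrite mem_below => ju; apply/ffunP => i.
  by rewrite -ext_val ext_mul // ext_gen ?lep_refl // ffunE.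
have -> : [seq gmul free_gmodule (a j) u (gen (a j) j) | j <- below u]
        = [seq gen u j | j <- below u] by apply/eq_in_map.
rewrite basisEdim size_map dimvf; apply/andP; split; last first.
  by rewrite /dim /= /dim /= muln1 card_seq_sub.
apply/subvP => c _.
have -> : c = \sum_i c i *: gen u (val i).
  apply/ffunP => i; rewrite sum_ffunE (bigD1 i) //= !ffunE eqxx.
  rewrite big1 ?addr0 => [|k ki]; first by rewrite [RHS]mulr1.
  by rewrite !ffunE eq_sym (inj_eq val_inj) (negPf ki) scaler0.
apply: memv_suml => i _; apply/memvZ/memv_span/map_f; exact: valP.
Qed.

End FreeModule.

Section Cover.
Variables (F : fieldType) (n : nat) (M : gmodule F n).

Definition box (u : point n) : seq (point n) :=
  [seq w <- undup [seq [ffun i => val (f i)]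
    | f : {ffun 'I_n -> 'I_(\sum_i u i).+1} <- enum {: {ffun 'I_n -> 'I_(\sum_i u i).+1}}]
    | w <=p u].

Lemma box_uniq u : uniq (box u).
Proof. exact/filter_uniq/undup_uniq. Qed.

Lemma mem_box u w : (w \in box u) = (w <=p u).
Proof.
rewrite mem_filter andb_idr // => /lepP wu; rewrite mem_undup.
apply/mapP; exists [ffun i => inord (w i) : 'I_(\sum_i u i).+1]; first by rewrite mem_enum.
apply/ffunP => i; rewrite !ffunE /= inordK // ltnS (leq_trans (wu i)) //.
by rewrite (bigD1 i) //= leq_addr.
Qed.

Definition cov_idx : choiceType := {w : point n & 'I_(\dim {:M w})}.
Definition cov_below (u : point n) : seq cov_idx :=
  [seq Tagged (fun w => 'I_(\dim {:M w})) k | w <- box u, k <- enum 'I_(\dim {:M w})].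

Lemma cov_below_uniq u : uniq (cov_below u).
Proof.
apply: allpairs_uniq_dep => [|w _|]; first exact: box_uniq.
  exact: enum_uniq.
by move=> [w k] [w' k'] _ _.
Qed.

Lemma mem_cov_below u j : (j \in cov_below u) = (tag j <=p u).
Proof.
apply/allpairsPdep/idP => [[w [k [wu _ ->]]]|]; first by rewrite -mem_box.
by case: j => w k /= wu; exists w, k; rewrite mem_box mem_enum.
Qed.

Definition cover : gmodule F n :=
  free_gmodule F mem_cov_below.

Definition cov_gen (j : cov_idx) : M (tag j) := (vbasis {:M (tag j)})`_(tagged j).

Definition cov_fun (u : point n) (c : cover u) : M u :=
  \sum_(j <- cov_below u) ext c j *: gmul M (tag j) u (cov_gen j).

Lemma cov_fun_linear u : linear (@cov_fun u).
Proof.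
move=> k c d; rewrite /cov_fun scaler_sumr -big_split /=.
by apply: eq_bigr => j _; rewrite ext_linear scalerDl scalerA.
Qed.
HB.instance Definition _ u := GRing.isLinear.Build F (cover u) (M u) _
  (@cov_fun u) (@cov_fun_linear u).

Lemma cov_mul u v : u <=p v ->
  (gmul M u v \o linfun (@cov_fun u))%VF
    = (linfun (@cov_fun v) \o gmul cover u v)%VF.
Proof.
move=> uv; apply/lfunP => c; rewrite !comp_lfunE 2!lfunE /= /cov_fun linear_sum /=.
transitivity (\sum_(j <- cov_below u)
    ext c j *: gmul M (tag j) v (cov_gen j)).
  apply: eq_big_seq => j; rewrite mem_cov_below => ju.
  by rewrite linearZ -(gmul_comp _ ju uv) comp_lfunE.
rewrite (perm_big [seq j <- cov_below v | j \in cov_below u]) /=; last first.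
  apply: uniq_perm; rewrite ?filter_uniq ?cov_below_uniq // => j.
  rewrite mem_filter andb_idr // !mem_cov_below => ju; exact: lep_trans ju uv.
rewrite big_filter big_mkcond /=; apply: eq_bigr => j _.
rewrite (ext_mul mem_cov_below) //; case: ifPn => // ju.
by rewrite (ext_out mem_cov_below) ?scale0r // -mem_cov_below.
Qed.

Definition cov_map : ghom cover M := GHom cov_mul.

Lemma cov_surj u : limg (cov_map u) = fullv.
Proof.
apply/eqP; rewrite eqEsubv subvf /= -(span_basis (vbasisP (fullv : {vspace M u}))).
apply/span_subvP => m /tnthP[k ->].
pose j : cov_idx := Tagged (fun w => 'I_(\dim {:M w})) k.
have ju : j \in cov_below u by rewrite mem_cov_below lep_refl.
suff -> : tnth (vbasis {:M u}) k
    = cov_map u (gen F cov_below u j).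
  by apply: memv_img; rewrite memvf.
rewrite lfunE /= /cov_fun (bigD1_seq j) ?cov_below_uniq //=.
rewrite (ext_gen _ mem_cov_below) ?lep_refl // eqxx scale1r.
rewrite gmul_id id_lfunE /cov_gen /= (tnth_nth 0).
rewrite big1 ?addr0 // => i ij.
by rewrite (ext_gen _ mem_cov_below) ?lep_refl // (negPf ij) scale0r.
Qed.

End Cover.

Section Kernel.
Variables (F : fieldType) (n : nat) (M N : gmodule F n) (f : ghom M N).

Definition ker_mul u v : 'Hom(subvs_of (lker (f u)), subvs_of (lker (f v))) :=
  linfun (vsproj (lker (f v)) \o gmul M u v \o vsval).

Lemma val_ker_mul u v y : u <=p v -> vsval (ker_mul u v y) = gmul M u v (vsval y).
Proof.
move=> uv; rewrite lfunE /= vsprojK // memv_ker -comp_lfunE -ghom_mul //.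
have := subvsP y; rewrite memv_ker comp_lfunE => /eqP->; by rewrite linear0.
Qed.

Lemma ker_mul_id u : ker_mul u u = \1%VF.
Proof.
apply/lfunP => y; apply: val_inj.
by rewrite [LHS]val_ker_mul ?lep_refl // gmul_id !id_lfunE.
Qed.

Lemma ker_mul_comp u v w : u <=p v -> v <=p w ->
  (ker_mul v w \o ker_mul u v)%VF = ker_mul u w.
Proof.
move=> uv vw; have uw := lep_trans uv vw; apply/lfunP => y; apply: val_inj.
rewrite comp_lfunE [LHS]val_ker_mul // [RHS]val_ker_mul //.
by rewrite -(gmul_comp _ uv vw) comp_lfunE; congr (gmul M v w _); apply: val_ker_mul.
Qed.

Definition ker_gmodule : gmodule F n :=
  @GModule F n (fun u => subvs_of (lker (f u))) ker_mul ker_mul_id ker_mul_comp.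

Lemma ker_incl_mul u v : u <=p v ->
  (gmul M u v \o linfun vsval)%VF
    = (linfun vsval \o gmul ker_gmodule u v)%VF :> 'Hom(subvs_of (lker (f u)), M v).
Proof.
by move=> uv; apply/lfunP => y; rewrite comp_lfunE [in RHS]comp_lfunE 2!lfunE [RHS]val_ker_mul.
Qed.

Definition ker_incl : ghom ker_gmodule M :=
  @GHom F n ker_gmodule M (fun u => linfun vsval) ker_incl_mul.

End Kernel.

Section Resolution.
Variables (F : fieldType) (n : nat).

Lemma ghom_comp_mul (L M N : gmodule F n) (g : ghom M N) (f : ghom L M) u v :
  u <=p v -> (gmul N u v \o (g u \o f u))%VF = ((g v \o f v) \o gmul L u v)%VF.
Proof.
by move=> uv; rewrite comp_lfunA ghom_mul // -comp_lfunA ghom_mul // comp_lfunA.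
Qed.
Definition ghom_comp (L M N : gmodule F n) (g : ghom M N) (f : ghom L M) :=
  GHom (ghom_comp_mul g f).

Variable M : gmodule F n.

Fixpoint syz (k : nat) : gmodule F n :=
  if k is k.+1 then ker_gmodule (cov_map (syz k)) else M.

Definition std_d k : ghom (cover (syz k.+1)) (cover (syz k)) :=
  ghom_comp (ker_incl (cov_map (syz k))) (cov_map (syz k.+1)).

Lemma limg_std_d k u : limg (std_d k u) = lker (cov_map (syz k) u).
Proof.
rewrite limg_comp cov_surj; apply/eqP; rewrite eqEsubv; apply/andP; split.
  by apply/subvP => _ /memv_imgP[y _ ->]; rewrite lfunE /= subvsP.
apply/subvP => x xK; apply/memv_imgP; exists (vsproj _ x); rewrite ?memvf //.
by rewrite lfunE /= vsprojK.
Qed.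

Lemma lker_std_d k u : lker (std_d k u) = lker (cov_map (syz k.+1) u).
Proof.
apply/vspaceP => x; rewrite !memv_ker comp_lfunE lfunE /=.
exact: (inj_eq val_inj _ 0).
Qed.

Definition std_resolution : free_resolution M.
Proof.
apply: (@FreeResolution F n M (fun k => cover (syz k)) _ std_d (cov_map M)).
- by move=> k; apply: free_gmodule_free; apply: cov_below_uniq.
- exact: cov_surj.
- exact: limg_std_d.
- by move=> k u; rewrite limg_std_d lker_std_d.
Defined.

End Resolution.

Record cell_complex (F : fieldType) := CellComplex {
  cell :> finType;
  cdim : cell -> nat;
  kappa : cell -> cell -> F;
  kappa_dim : forall t s, kappa t s != 0 -> cdim t = (cdim s).+1;
  kappa_sq : forall t s, \sum_(r : cell) kappa t r * kappa r s = 0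
}.

(* s <= t in the face order, generated by the pairs with kappa t s != 0 *)
Definition face (F : fieldType) (X : cell_complex F) (s t : X) : bool :=
  connect (fun s t => kappa t s != 0) s t.

Definition subcomplex (F : fieldType) (X : cell_complex F) (A : {set X}) :=
  forall s t : X, t \in A -> face s t -> s \in A.

Section Chains.
Variables (F : fieldType) (X : cell_complex F).

(* All chain groups live in the space of functions X -> F, i.e. in the direct
   sum of the C_q(X); C_q(A) is spanned by the q-cells of A, and bd restricts
   to the boundary map of degree q on C_q(X).  In particular it vanishes on
   C_0(X), by kappa_dim. *)
Notation chain := {ffun X -> F^o}.

Definition single (s : X) : chain := [ffun t => (t == s)%:R].

Definition bd_fun (c : chain) : chain := [ffun s => \sum_t c t * kappa t s].

Lemma bd_fun_is_linear : linear bd_fun.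
Proof.
move=> a c d; apply/ffunP => s; rewrite !ffunE scaler_sumr -big_split /=.
by apply: eq_bigr => t _; rewrite !ffunE mulrDl -scalerAl.
Qed.
HB.instance Definition _ :=
  GRing.isLinear.Build F chain chain _ bd_fun bd_fun_is_linear.

Definition bd : 'End(chain) := linfun bd_fun.

Definition Cq (q : nat) (A : {set X}) : {vspace chain} :=
  (\sum_(s in A | cdim s == q) <[single s]>)%VS.
Definition Zq (q : nat) (A : {set X}) : {vspace chain} :=
  (Cq q A :&: lker bd)%VS.
Definition Bq (q : nat) (A : {set X}) : {vspace chain} :=
  (bd @: Cq q.+1 A)%VS.
Definition Hq (q : nat) (A : {set X}) := subquo (Zq q A) (Bq q A).

Lemma bd_single s : bd (single s) = \sum_t kappa s t *: single t.
Proof.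
rewrite lfunE; apply/ffunP => t; rewrite ffunE sum_ffunE.
rewrite (bigD1 s) //= ffunE eqxx mul1r big1 ?addr0 => [|r rs]; last first.
  by rewrite ffunE (negPf rs) mul0r.
rewrite (bigD1 t) //= !ffunE eqxx big1 ?addr0 => [|r rt]; last first.
  by rewrite !ffunE eq_sym (negPf rt) scaler0.
by rewrite [RHS]mulr1.
Qed.

Lemma single_Cq q (A : {set X}) s :
  s \in A -> cdim s = q -> single s \in Cq q A.
Proof.
move=> sA sq; apply: subvP (memv_line (single s)).
by apply: (sumv_sup s); rewrite ?sA ?sq ?eqxx.
Qed.

Lemma bd_bd c : bd (bd c) = 0.
Proof.
rewrite !lfunE; apply/ffunP => s; rewrite !ffunE.
under eq_bigr => t _ do rewrite ffunE mulr_suml.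
rewrite exchange_big big1 //= => t _.
under eq_bigr => r _ do rewrite -mulrA.
by rewrite -mulr_sumr [X in _ * X](kappa_sq t s) mulr0.
Qed.

Lemma Cq_mono q (A B : {set X}) : A \subset B -> (Cq q A <= Cq q B)%VS.
Proof.
move=> /subsetP sAB; apply/subv_sumP => s /andP[sA sq].
by rewrite -memvE single_Cq ?(eqP sq) ?sAB.
Qed.

Lemma Zq_mono q (A B : {set X}) : A \subset B -> (Zq q A <= Zq q B)%VS.
Proof. by move=> sAB; apply: capvS => //; apply: Cq_mono. Qed.

Lemma Bq_mono q (A B : {set X}) : A \subset B -> (Bq q A <= Bq q B)%VS.
Proof. by move=> sAB; apply: limgS; apply: Cq_mono. Qed.

Lemma Bq_sub_Zq q (A : {set X}) : subcomplex A -> (Bq q A <= Zq q A)%VS.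
Proof.
move=> subA; rewrite subv_cap; apply/andP; split; last first.
  by apply/subvP => _ /memv_imgP[c _ ->]; rewrite memv_ker bd_bd.
rewrite /Bq /Cq limg_sum; apply/subv_sumP => t /andP[tA tq].
rewrite limg_line -memvE bd_single; apply: memv_suml => s _.
have [->|k0] := eqVneq (kappa t s) 0; first by rewrite scale0r mem0v.
apply/memvZ/single_Cq.
  by apply: subA tA _; apply: connect1.
by apply/eqP; rewrite -eqSS -(kappa_dim k0).
Qed.

End Chains.

Record filtration (F : fieldType) (X : cell_complex F) (n : nat) := Filtration {
  fil :> point n -> {set X};
  fil_subcomplex : forall u, subcomplex (fil u);
  fil_mono : forall u v, u <=p v -> fil u \subset fil v
}.

Definition exhaustive (F : fieldType) (X : cell_complex F) (n : nat)
    (Xf : filtration X n) : Prop :=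
  forall s : X, exists u, s \in Xf u.

Definition one_critical (F : fieldType) (X : cell_complex F) (n : nat)
    (Xf : filtration X n) : Prop :=
  exists h : X -> point n,
    (forall s t, face s t -> h s <=p h t) /\
    (forall u, Xf u = [set s | h s <=p u]).

(* X^w for w in Z^n: empty unless w lies in N^n *)
Definition fil_at (F : fieldType) (X : cell_complex F) (n : nat)
    (Xf : filtration X n) (w : {ffun 'I_n -> int}) : {set X} :=
  if [forall i, 0 <= w i] then Xf [ffun i => absz (w i)] else set0.

Definition zpt (n : nat) (u : point n) : {ffun 'I_n -> int} :=
  [ffun i => (u i)%:Z].
Definition evec (n : nat) (j : 'I_n) : {ffun 'I_n -> int} :=
  [ffun i => (i == j)%:Z].

Section PersistentHomology.
Variables (F : fieldType) (X : cell_complex F) (n : nat) (Xf : filtration X n).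
Variable q : nat.

Definition Vq_mul (u v : point n) : 'Hom(Hq q (Xf u), Hq q (Xf v)) :=
  ind \1%VF (Zq q (Xf u)) (Bq q (Xf u)) (Zq q (Xf v)) (Bq q (Xf v)).

Lemma Vq_mulE u v c : u <=p v -> c \in Zq q (Xf u) ->
  Vq_mul u v (cls _ _ c) = cls _ _ c.
Proof.
move=> uv cZ; have sub := fil_mono Xf uv.
rewrite /Vq_mul indE ?lim1g ?id_lfunE //.
- exact/Bq_sub_Zq/fil_subcomplex.
- exact: Zq_mono.
- exact: Bq_mono.
Qed.

Lemma Vq_mul_id u : Vq_mul u u = \1%VF.
Proof.
apply/lfunP => y; rewrite id_lfunE -{1}(cls_repr y) Vq_mulE ?lep_refl //.
  exact: cls_repr.
exact: repr_mem.
Qed.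

Lemma Vq_mul_comp u v w : u <=p v -> v <=p w ->
  (Vq_mul v w \o Vq_mul u v)%VF = Vq_mul u w.
Proof.
move=> uv vw; apply/lfunP => y; rewrite comp_lfunE -(cls_repr y).
have yZ := repr_mem y; have uw := lep_trans uv vw.
rewrite !Vq_mulE //.
by apply: subvP yZ; apply/Zq_mono/fil_mono.
Qed.

(* V_q: the sum of the H_q(X^u), S acting through the inclusions *)
Definition Vq : gmodule F n :=
  @GModule F n (fun u => Hq q (Xf u)) Vq_mul Vq_mul_id Vq_mul_comp.

(* xi_i^q(u), computed from a graded free resolution P of V_q *)
Definition xi (P : free_resolution Vq) (i : nat) (u : point n) : nat :=
  tor_dim P i u.

End PersistentHomology.

(* Main.v *)
(** Let P be a free resolution of V_q, K the kernel of the augmentation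
    P_0 -> V_q and m = <x_1, ..., x_n>.  Then Tor_1(V_q, F)^u vanishes as soon as
    (K ∩ m P_0)^u lies in (m K)^u.  An element of the left-hand side is a sum of
    x_j p_j, where p_j in degree u - e_j lies over the class of a cycle z_j of
    X^(u - e_j); by the hypothesis on boundaries the z_j can be chosen with sum 0
    in the chain group.  The hypothesis on cycles then writes the last z_l as a
    sum of cycles w_j of X^(u - e_j - e_l), j < l; lifting the class of w_j to
    q_j in P_0 and replacing p_l by p_l - sum_j x_j q_j, which lies in K, and p_j
    by p_j + x_l q_j, one concludes by induction on the number of summands. *)
Require Import Defs.
From mathcomp Require Import all_boot all_order all_fingroup all_algebra.

Import GRing.Theory.
Local Open Scope ring_scope.

(** The carrier [U :\: W] lies in [U], hence in [W], and meets [W] trivially. *)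
Lemma subquo_dim0 (F : fieldType) (vT : vectType F) (U W : {vspace vT}) :
  (U <= W)%VS -> \dim (fullv : {vspace subquo U W}) = 0%N.
Proof.
move=> sUW; have UW0 : (U :\: W <= 0)%VS.
  rewrite -(capv_diff U W) subv_cap subvv.
  exact: subv_trans (diffvSl U W) sUW.
apply/eqP; rewrite dimv_eq0 -subv0; apply/subvP => y _.
have := subvP UW0 _ (subvsP y); rewrite !memv0 => /eqP y0.
exact/eqP/val_inj.
Qed.

Lemma ghomE (F : fieldType) (n : nat) (M N : gmodule F n) (f : ghom M N)
    (u v : point n) (x : M u) :
  u <=p v -> f v (gmul M u v x) = gmul N u v (f u x).
Proof. by move=> uv; rewrite -!comp_lfunE ghom_mul. Qed.

Lemma ghom_maxM (F : fieldType) (n : nat) (M N : gmodule F n) (f : ghom M N)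
    (u : point n) : (f u @: maxM M u <= maxM N u)%VS.
Proof.
rewrite /maxM limg_sum; apply/subv_sumP => j uj.
apply: (sumv_sup j) => //; apply/subvP => _ /memv_imgP[_ /memv_imgP[x _ ->] ->].
by rewrite ghomE ?lep_pred // memv_img ?memvf.
Qed.

Lemma tensF_mapE (F : fieldType) (n : nat) (M N : gmodule F n) (f : ghom M N)
    (u : point n) (x : M u) :
  tensF_map f u (cls fullv (maxM M u) x) = cls fullv (maxM N u) (f u x).
Proof. by rewrite /tensF_map indE ?subvf ?ghom_maxM ?memvf. Qed.

(* (m K)^u, for K = ker f and m = <x_1, ..., x_n> *)
Definition max_ker {F : fieldType} {n : nat} {M N : gmodule F n} (f : ghom M N)
    (u : point n) : {vspace M u} :=
  (\sum_(j < n | (0 < u j)%N)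
     gmul M (pred_pt u j) u @: lker (f (pred_pt u j)))%VS.

(** A cycle of P_1 ⊗ F is the class of some [x] with d x in K ∩ m P_0, hence in m K. Since K = im d,
    each summand of d x lifts, so d x = d y with [y] in m P_1. By exactness [x - y] comes from P_2,
    and [y] dies in P_1 ⊗ F, so the class of [x] is a boundary. *)
Lemma tor1_dim0 (F : fieldType) (n : nat) (M : gmodule F n)
    (P : free_resolution M) (u : point n) :
  (lker (fr_aug P u) :&: maxM (P 0%N) u <= max_ker (fr_aug P) u)%VS ->
  tor_dim P 1 u = 0%N.
Proof.
move=> capK; apply: subquo_dim0; apply/subvP => t /=.
rewrite memv_ker -(cls_repr t); set x := repr_sq _ _ t.
rewrite tensF_mapE clsE0 ?memvf // => dx_max.
have /memv_sumP[k kK dxE] : fr_d P 0 u x \in max_ker (fr_aug P) u.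
  apply: (subvP capK); rewrite memv_cap dx_max andbT -fr_exact0.
  by rewrite memv_img ?memvf.
have kd j : (0 < u j)%N -> exists2 c : P 1 (pred_pt u j),
    true & k j = fr_d P 0 u (gmul (P 1) (pred_pt u j) u c).
  move=> uj; have /memv_imgP[y] := kK j uj.
  rewrite -fr_exact0 => /memv_imgP[c _ ->] ->; exists c => //.
  by rewrite ghomE ?lep_pred.
have [y y_max dy] : exists2 y, y \in maxM (P 1) u & fr_d P 0 u y = fr_d P 0 u x.
  rewrite dxE; apply: (big_ind (fun s => exists2 y, y \in maxM (P 1) u &
      fr_d P 0 u y = s)) => [|_ _ [y1 m1 <-] [y2 m2 <-]|j uj].
  - by exists 0; rewrite ?mem0v ?linear0.
  - by exists (y1 + y2); rewrite ?memvD ?linearD.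
  have [c _ ->] := kd j uj; eexists; last reflexivity.
  by apply: subvP (memv_img _ (memvf c)); apply: (sumv_sup j).
have : x - y \in lker (fr_d P 0 u) by rewrite memv_ker linearB /= dy subrr.
rewrite -fr_exact => /memv_imgP[w _ xyE].
have -> : cls fullv (maxM (P 1) u) x = tensF_map (fr_d P 1) u (cls fullv _ w).
  rewrite tensF_mapE -xyE linearB /=.
  suff /eqP -> : cls fullv (maxM (P 1) u) y == 0 by rewrite subr0.
  by rewrite clsE0 ?memvf.
by rewrite memv_img ?memvf.
Qed.

Section Shifts.
Variables (F : fieldType) (X : cell_complex F) (n : nat) (Xf : filtration X n).
Variable u : point n.

(** [pred_pt] truncates at 0, so it agrees with the integer translate only if [0 < u j]; otherwise
    the translate leaves N^n. *)
Lemma fil_at_pred (j : 'I_n) :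
  fil_at Xf (zpt u - evec j) = if (0 < u j)%N then Xf (pred_pt u j) else set0.
Proof.
rewrite /fil_at; case: ifPn => [/forallP u0|]; last first.
  rewrite negb_forall => /existsP[i]; rewrite !ffunE.
  by case: eqVneq => [->|_]; [case: (u j) | rewrite subr0].
have := u0 j; rewrite !ffunE eqxx; case: (posnP (u j)) => [->|uj _] //.
congr (Xf _); apply/ffunP => i; rewrite !ffunE.
by case: eqVneq => [->|_]; [rewrite subzn | rewrite subr0 subn0].
Qed.

(** For [j = l] the translate would stay in N^n only if [u j] were at least 2. *)
Lemma fil_at_pred2 (j l : 'I_n) : j != l ->
  fil_at Xf (zpt u - evec j - evec l) =
    if (0 < u j)%N && (0 < u l)%N then Xf (pred_pt (pred_pt u j) l) else set0.
Proof.
move=> jl; have lj : l != j by rewrite eq_sym.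
rewrite /fil_at; case: ifPn => [/forallP u0|]; last first.
  rewrite negb_forall => /existsP[i]; rewrite !ffunE.
  case: (eqVneq i j) => [->|_]; first by rewrite (negPf jl) subr0; case: (u j).
  by case: eqVneq => [->|_]; rewrite ?subr0 //; case: (u l); rewrite ?andbF.
have := u0 j; have := u0 l; rewrite !ffunE !eqxx (negPf jl) (negPf lj) !subr0.
case: (posnP (u l)) => [->|ul _] //; case: (posnP (u j)) => [->|uj _] //=.
congr (Xf _); apply/ffunP => i; rewrite !ffunE.
case: (eqVneq i j) => [->|_]; first by rewrite (negPf jl) subr0 subn0 subzn.
by case: eqVneq => [->|_]; rewrite ?subr0 !subn0 ?subzn.
Qed.

Lemma Cq_set0 q : Cq q (set0 : {set X}) = 0%VS.
Proof. by rewrite /Cq big1 // => s; rewrite inE. Qed.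

Lemma Zq_set0 q : Zq q (set0 : {set X}) = 0%VS.
Proof. by rewrite /Zq Cq_set0 cap0v. Qed.

Lemma Bq_set0 q : Bq q (set0 : {set X}) = 0%VS.
Proof. by rewrite /Bq Cq_set0 limg0. Qed.

End Shifts.

Section Lift.
Variables (F : fieldType) (X : cell_complex F) (n : nat) (Xf : filtration X n).
Variables (q : nat) (u : point n) (N : gmodule F n) (f : ghom N (Vq Xf q)).
Hypothesis f_surj : forall v, limg (f v) = fullv.

Notation chain := {ffun X -> F^o}.

(** The induction runs over the first [m] indices in the order [rho]. The [z j] are arbitrary
    cycles, since each step changes them. Where [u (rho j) = 0], [p j] has no meaning and is left
    out of the sum, while [z j] is forced to be 0. *)
Lemma zero_sum_lift (rho : 'S_n)
    (hZ : forall l : 'I_n,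
      (Zq q (fil_at Xf (zpt u - evec (rho l))) :&:
        \sum_(j < n | (j < l)%N) Zq q (fil_at Xf (zpt u - evec (rho j))))%VS =
      (\sum_(j < n | (j < l)%N)
        Zq q (fil_at Xf (zpt u - evec (rho j) - evec (rho l))))%VS)
    (m : nat) (z : 'I_n -> chain) (p : forall j, N (pred_pt u (rho j))) :
  (m <= n)%N ->
  (forall j : 'I_n, (j < m)%N -> z j \in Zq q (fil_at Xf (zpt u - evec (rho j)))) ->
  (forall j : 'I_n, (j < m)%N -> (0 < u (rho j))%N -> f _ (p j) = cls _ _ (z j)) ->
  \sum_(j < n | (j < m)%N) z j = 0 ->
  \sum_(j < n | (j < m)%N && (0 < u (rho j))%N) gmul N _ u (p j)
    \in max_ker f u.
Proof.
elim: m z p => [|m IHm] z p mn zZ pz z0; first by rewrite big_pred0 ?mem0v.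
pose l := Ordinal mn.
have ltS (j : 'I_n) : (j < m.+1)%N && (j != l) = (j < l)%N.
  by rewrite -val_eqE /= ltnS ltn_neqAle andbC.
have zlE : z l = - \sum_(j < n | (j < l)%N) z j.
  move: z0; rewrite (bigD1 l) //= (eq_bigl _ _ ltS) => /eqP.
  by rewrite addr_eq0 => /eqP.
have [ul|ul] := posnP (u (rho l)).
  have zl0 : z l = 0.
    by apply/eqP; have := zZ l (ltnSn m); rewrite fil_at_pred ul Zq_set0 memv0.
  rewrite (eq_bigl (fun j : 'I_n => (j < m)%N && (0 < u (rho j))%N)).
    apply: (IHm z p (ltnW mn)) => [j jm|j jm|]; try by auto using ltnW.
    by apply/eqP; rewrite -oppr_eq0 -zlE zl0.
  move=> j; rewrite -[(j < m)%N]ltS; case: eqVneq => [->|_].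
    by rewrite ul !andbF.
  by rewrite andbT.
have /memv_sumP[w wZ zlw] : z l \in (\sum_(j < n | (j < l)%N)
    Zq q (fil_at Xf (zpt u - evec (rho j) - evec (rho l))))%VS.
  rewrite -hZ memv_cap zZ //= zlE memvN; apply: memv_suml => j jl.
  by apply: subvP (zZ j (ltnW jl)); apply: (sumv_sup j).
have neq (j : 'I_n) : (j < l)%N -> rho j != rho l.
  by move=> jl; rewrite (inj_eq perm_inj) -val_eqE /= ltn_eqF.
pose a (j : 'I_n) := pred_pt u (rho j).
pose c (j : 'I_n) := pred_pt (a j) (rho l).
have ca j : c j <=p a j by apply: lep_pred.
have cl j : c j <=p a l by apply/lepP => i; rewrite !ffunE leq_sub2r ?leq_subr.
have wZc (j : 'I_n) : (j < l)%N && (0 < u (rho j))%N -> w j \in Zq q (Xf (c j)).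
  by case/andP=> jl uj; have := wZ j jl; rewrite fil_at_pred2 ?neq // uj ul.
have w0 (j : 'I_n) : (j < l)%N -> u (rho j) = 0%N -> w j = 0.
  move=> jl uj; apply/eqP; have := wZ j jl.
  by rewrite fil_at_pred2 ?neq // uj Zq_set0 memv0.
(* A lift of the class of [w j]; the pseudo-inverse yields a true preimage because [f] is onto. *)
pose r (j : 'I_n) : N (c j) :=
  (f (c j))^-1%VF (cls (Zq q (Xf (c j))) (Bq q (Xf (c j))) (w j)).
have frE j : f (c j) (r j) = cls _ _ (w j).
  by rewrite limg_lfunVK // f_surj memvf.
have frv (j : 'I_n) v : (j < l)%N && (0 < u (rho j))%N -> c j <=p v ->
    f v (gmul N (c j) v (r j)) = cls _ _ (w j).
  by move=> jl cv; rewrite ghomE // frE [LHS]Vq_mulE // wZc.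
(* As the [w j] add up to [z l], the [z' j] with [j < m] again have sum 0, and [p' j] lies over
   [z' j]. *)
pose z' j := z j + w j.
pose p' j := p j + gmul N (c j) (a j) (r j).
have IH : \sum_(j < n | (j < m)%N && (0 < u (rho j))%N) gmul N _ u (p' j)
    \in max_ker f u.
  apply: (IHm z' p' (ltnW mn)) => [j jm|j jm uj|].
  - apply: memvD; first exact: zZ (ltnW jm).
    have [uj|uj] := posnP (u (rho j)).
      by rewrite w0 ?mem0v.
    rewrite fil_at_pred uj; apply: subvP (wZc j _); last by rewrite jm.
    exact/Zq_mono/fil_mono.
  - by rewrite /z' !linearD /= frv ?jm // pz ?ltnS ?(ltnW jm).
  by rewrite big_split /= -zlw zlE addrN.
(* [k] lies over the class of [z l] minus the sum of the [w j], which is 0. *)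
pose k := p l - \sum_(j < n | (j < l)%N && (0 < u (rho j))%N)
  gmul N (c j) (a l) (r j).
have kK : k \in lker (f (a l)).
  rewrite memv_ker linearB /= pz //= linear_sum /= subr_eq0; apply/eqP.
  rewrite zlw linear_sum /= (bigID (fun j : 'I_n => (0 < u (rho j))%N)) /=.
  rewrite [X in _ + X]big1 ?addr0 => [|j /andP[jl]]; last first.
    by rewrite -eqn0Ngt => /eqP uj; rewrite w0 ?linear0.
  by apply: eq_bigr => j jl; rewrite frv.
(* The corrections cancel in degree [u]: passing from [c j] to [u] through [a j] or through [a l]
   gives the same map. *)
suff -> : \sum_(j < n | (j < m.+1)%N && (0 < u (rho j))%N) gmul N (a j) u (p j) =
    \sum_(j < n | (j < m)%N && (0 < u (rho j))%N) gmul N (a j) u (p' j) +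
    gmul N (a l) u k.
  rewrite memvD //; apply: subvP (memv_img _ kK).
  exact: (sumv_sup (rho l)).
rewrite (bigD1 l) /= ?ltnSn ?ul // linearB /= addrCA; congr (_ + _).
under [X in _ = X - _]eq_bigr do rewrite /p' linearD /=.
rewrite big_split /= linear_sum /= -addrA -sumrB [X in _ + X]big1 ?addr0 => [|j jl].
  by apply: eq_bigl => j; rewrite andbAC ltS.
by rewrite -!comp_lfunE !gmul_comp ?lep_pred ?subrr.
Qed.

Lemma lker_cap_maxM (rho : 'S_n)
    (hB : Bq q (Xf u) =
      (\sum_(j < n) Bq q (fil_at Xf (zpt u - evec j)))%VS)
    (hZ : forall l : 'I_n,
      (Zq q (fil_at Xf (zpt u - evec (rho l))) :&:
        \sum_(j < n | (j < l)%N) Zq q (fil_at Xf (zpt u - evec (rho j))))%VS =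
      (\sum_(j < n | (j < l)%N)
        Zq q (fil_at Xf (zpt u - evec (rho j) - evec (rho l))))%VS) :
  (lker (f u) :&: maxM N u <= max_ker f u)%VS.
Proof.
apply/subvP => y; rewrite memv_cap memv_ker => /andP[/eqP fy0].
case/memv_sumP=> v vN yE.
pose p j : N (pred_pt u j) := (gmul N (pred_pt u j) u)^-1%VF (v j).
have pE j : (0 < u j)%N -> gmul N (pred_pt u j) u (p j) = v j.
  by move=> uj; rewrite limg_lfunVK // vN.
(* The default 0 is the only cycle of the empty complex at [u - e_j]. *)
pose z j : chain := if (0 < u j)%N then repr_sq _ _ (f _ (p j)) else 0.
have zZ j : z j \in Zq q (fil_at Xf (zpt u - evec j)).
  by rewrite fil_at_pred /z; case: ifP; rewrite ?mem0v ?repr_mem.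
(* The sum of the [z j] represents [f u y = 0], so it is a boundary in [Xf u], and [hB] splits it
   into boundaries [b j] of the smaller complexes. *)
have /memv_sumP[b bB zbE] :
    \sum_j z j \in (\sum_(j < n) Bq q (fil_at Xf (zpt u - evec j)))%VS.
  have zZu j : z j \in Zq q (Xf u).
    rewrite /z; case: ifP; rewrite ?mem0v // => _.
    apply: (subvP (Zq_mono _ (fil_mono _ (lep_pred u j)))); exact: repr_mem.
  rewrite -hB -(@clsE0 _ _ (Zq q (Xf u))); last by apply: memv_suml.
  apply/eqP; rewrite -[RHS]fy0 yE !linear_sum /= (bigID (fun j => (0 < u j)%N)) /=.
  rewrite [X in _ + X]big1 ?addr0 => [|j]; last first.
    by rewrite /z => /negPf->; rewrite linear0.
  apply: eq_bigr => j uj; rewrite -pE // (ghomE _ _ _ _ f) ?lep_pred //.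
  rewrite -[f _ (p j)]cls_repr [RHS]Vq_mulE ?lep_pred ?repr_mem //.
  by rewrite /z uj.
(* Subtracting [b j] keeps the class of [z j] and makes the total sum 0 as a chain. *)
have zbZ (j : 'I_n) : z j - b j \in Zq q (fil_at Xf (zpt u - evec j)).
  rewrite memvB // fil_at_pred; have := bB j isT; rewrite fil_at_pred.
  case: ifP => _; last by rewrite Bq_set0 Zq_set0.
  exact/subvP/Bq_sub_Zq/fil_subcomplex.
have sum_zb0 : \sum_(j < n | (j < n)%N) (z (rho j) - b (rho j)) = 0.
  under eq_bigl do rewrite ltn_ord.
  by rewrite -[RHS](subrr (\sum_j z j)) {2}zbE -sumrB [RHS](reindex_perm rho).
rewrite yE -(eq_bigr _ pE) (reindex_perm rho) /=.
rewrite (eq_bigl (fun j : 'I_n => (j < n)%N && (0 < u (rho j))%N)) => [|j]; last first.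
  by rewrite ltn_ord.
apply: (@zero_sum_lift rho hZ n _ (fun j => p (rho j)) (leqnn n) _ _ sum_zb0) => // j _ uj.
have := bB (rho j) isT; rewrite fil_at_pred uj => bBj.
rewrite linearB /= /z uj cls_repr.
suff /eqP -> : cls (Zq q (Xf (pred_pt u (rho j)))) (Bq q (Xf (pred_pt u (rho j))))
    (b (rho j)) == 0 by rewrite subr0.
rewrite clsE0 //; move: bBj; apply/subvP/Bq_sub_Zq; exact: fil_subcomplex.
Qed.

End Lift.

Theorem theorem5p14 (F : fieldType) (n : nat) (n_ge1 : (1 <= n)%N) (q : nat)
    (X : cell_complex F) (Xf : filtration X n)
    (Xf_one_critical : one_critical Xf) (Xf_exhaustive : exhaustive Xf)
    (u : point n)
    (hB : Bq q (Xf u) =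
      (\sum_(j < n) Bq q (fil_at Xf (zpt u - evec j)))%VS)
    (hZ : exists rho : 'S_n, forall l : 'I_n,
      (Zq q (fil_at Xf (zpt u - evec (rho l))) :&:
        \sum_(j < n | (j < l)%N) Zq q (fil_at Xf (zpt u - evec (rho j))))%VS =
      (\sum_(j < n | (j < l)%N)
        Zq q (fil_at Xf (zpt u - evec (rho j) - evec (rho l))))%VS)
    (P : free_resolution (Vq Xf q)) :
  xi P 1 u = 0%N.
Proof.
by case: hZ => rho hZr; apply: tor1_dim0; apply: lker_cap_maxM hB hZr; apply: fr_aug_surj.
Qed.
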